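(* Let $(\bar N,g)$ be an $n$-dimensional Riemannian manifold isometrically embedded in $\mathbb{R}^S$, $N\subset\bar N$ compact, and $1\le m\le n-1$. The following are equivalent: (i) $N$ contains no non-zero $m$-varifold with null weak mean curvature relative to $\bar N$; (ii) there exist an increasing $\Phi:[0,\infty)\to[0,\infty)$ with $\Phi(0)=0$ and $F:G_m(N)\times\mathbb{R}^S\to[0,\infty)$ satisfying condition (F) such that every $m$-varifold $V$ on $N$ with weak mean curvature $H^N$ relative to $\bar N$ satisfies $|V|\le\Phi\big(\int_{G_m(N)}F(x,P,H^N)\,dV\big)$; (iii) for every $F:G_m(N)\times\mathbb{R}^S\to[0,\infty)$ satisfying condition (F) there is $C_F>0$ such that every $m$-varifold $V$ on $N$ with weak mean curvature $H^N$ relative to $\bar N$ satisfies $|V|\le C_F\int_{G_m(N)}F(x,P,H^N)\,dV$.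
   Context: $G(S,m)$ is the Grassmannian of $m$-planes in $\mathbb{R}^S$, each $P$ identified with its orthogonal projection matrix $(P_{ij})$; $Q(x)=(Q_{ij}(x))$ is the orthogonal projection onto $T_x\bar N$; $G_m(N)=\{(x,P):x\in N,\ P\subset T_x\bar N\}$. An $m$-varifold on $N$ is any Radon measure $V$ on $G_m(N)$; $|V|=V(G_m(N))$. Weak mean curvature in $\mathbb{R}^S$: $\mathbb{R}^S$-valued $H\in L^1_{loc}(V)$ with $\int\operatorname{div}_PX\,dV=-\int H\cdot X\,dV$ for all $X\in C^1_c(\mathbb{R}^S;\mathbb{R}^S)$, $\operatorname{div}_PX=\sum_{i,j}P_{ij}\partial_jX^i$. $V$ on $N$ has weak mean curvature $H^N$ relative to $\bar N$ if as a varifold in $\mathbb{R}^S$ it has weak mean curvature $H^{\mathbb{R}^S}$; then $(H^N)_i=(H^{\mathbb{R}^S})_i-\sum_{j,k}P_{jk}\partial_{x_k}Q_{ij}(x)$. Condition (F) on $F:G_m(N)\times\mathbb{R}^\alpha\to\mathbb{R}$: continuous; $F\ge0$ with $F(x,P,q)=0$ iff $q=0$; convex in $q$; there is a continuous $\phi\ge0$, nondecreasing in $t$, $\phi(x,P,t)\to\infty$ locally uniformly as $t\to\infty$, with $\phi(x,P,|q|)|q|\le F(x,P,q)$. *)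

(* Defs.v *)
From HB Require Import structures.
From mathcomp Require Import all_boot all_order all_algebra.
From mathcomp Require Import all_classical all_reals all_analysis.
Import Order.TTheory GRing.Theory Num.Theory.
Import numFieldNormedType.Exports.

Set Implicit Arguments.
Unset Strict Implicit.
Unset Printing Implicit Defensive.

Local Open Scope classical_set_scope.
Local Open Scope ring_scope.

Section Varifolds.
Variables (R : realType) (S : nat).

Fixpoint Ck (k : nat) (U V : normedModType R) (f : U -> V) : Prop :=
  match k with
  | 0 => continuous f
  | k'.+1 => (forall x, differentiable f x) /\
             (forall v : U, Ck k' (fun x => 'D_v f x))
  end.

Definition smooth (U V : normedModType R) (f : U -> V) : Prop :=
  forall k, Ck k f.

Definition ebasis (k : 'I_S) : 'rV[R]_S := delta_mx 0 k.

Definition dotp (u v : 'rV[R]_S) : R := \sum_(i < S) u 0 i * v 0 i.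
Definition enorm (u : 'rV[R]_S) : R := Num.sqrt (dotp u u).

(* Nbar is an n-dimensional smooth embedded submanifold of R^S
   (with the induced Riemannian metric): locally the regular zero set of a
   smooth map R^S -> R^(S-n). *)
Definition submanifold (n : nat) (Nbar : set 'rV[R]_S) : Prop :=
  (n <= S)%N /\
  forall p, Nbar p ->
    exists (U : set 'rV[R]_S) (f : 'rV[R]_S -> 'rV[R]_(S - n)),
      [/\ open U, U p, smooth f,
          (forall x, U x -> (Nbar x <-> f x = 0)) &
          (forall x, U x -> Nbar x ->
             forall w : 'rV[R]_(S - n), exists v, 'D_v f x = w)].

Definition tangent (Nbar : set 'rV[R]_S) (x v : 'rV[R]_S) : Prop :=
  exists c : R -> 'rV[R]_S,
    [/\ c 0 = x, \forall t \near (0 : R), Nbar (c t) & is_derive (0 : R) (1 : R) c v].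

Definition orth_proj (A : 'M[R]_S) (W : set 'rV[R]_S) : Prop :=
  [/\ A^T = A, A *m A = A & forall v, W v <-> v *m A = v].

Definition grass (m : nat) (P : 'M[R]_S) : Prop :=
  P^T = P /\ P *m P = P /\ \rank P = m.

Definition pts := ('rV[R]_S * 'M[R]_S)%type.

Definition borel_pts := g_sigma_algebraType (@open pts).

Definition GmN (m : nat) (Nbar N : set 'rV[R]_S) : set pts :=
  [set z | [/\ N z.1, grass m z.2 &
              forall v, v *m z.2 = v -> tangent Nbar z.1 v]].

(* an m-varifold on N: a Radon (= finite Borel, as the support is compact)
   measure on G_m(N), seen as a Borel measure on pts concentrated on G_m(N) *)
Definition varifold_on (m : nat) (Nbar N : set 'rV[R]_S)
    (V : {measure set borel_pts -> \bar R}) : Prop :=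
  (V setT < +oo)%E /\ V (~` GmN m Nbar N) = 0%E.

Definition C1c (X : 'rV[R]_S -> 'rV[R]_S) : Prop :=
  [/\ forall x, differentiable X x,
      forall j : 'I_S, continuous (fun x => 'D_(ebasis j) X x) &
      exists K, compact K /\ forall x, ~ K x -> X x = 0].

Definition divP (P : 'M[R]_S) (X : 'rV[R]_S -> 'rV[R]_S) (x : 'rV[R]_S) : R :=
  \sum_(i < S) \sum_(j < S) P i j * 'D_(ebasis j) (fun y => X y 0 i) x.

Definition has_wmc (V : {measure set borel_pts -> \bar R})
    (H : borel_pts -> 'rV[R]_S) : Prop :=
  (forall i : 'I_S, V.-integrable setT (fun z => (H z 0 i)%:E)) /\
  forall X, C1c X ->
    (\int[V]_z (divP z.2 X z.1)%:E = - \int[V]_z (dotp (H z) (X z.1))%:E)%E.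

(* Qt is a C^1 extension, near N, of the field x |-> Q(x) of orthogonal
   projections onto T_x Nbar (only its tangential derivatives matter). *)
Definition Q_ext (Nbar N : set 'rV[R]_S) (Qt : 'rV[R]_S -> 'M[R]_S) : Prop :=
  exists W : set 'rV[R]_S,
    [/\ open W, N `<=` W,
        forall x, W x -> Nbar x -> orth_proj (Qt x) (tangent Nbar x),
        forall x, W x -> differentiable Qt x &
        forall k : 'I_S, {in W, continuous (fun x => 'D_(ebasis k) Qt x)}].

Definition Qcorr (Qt : 'rV[R]_S -> 'M[R]_S) (z : pts) : 'rV[R]_S :=
  \row_(i < S) \sum_(j < S) \sum_(k < S)
      z.2 j k * 'D_(ebasis k) (fun y => Qt y i j) z.1.

Definition has_wmc_rel (m : nat) (Nbar N : set 'rV[R]_S)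
    (V : {measure set borel_pts -> \bar R}) (HN : borel_pts -> 'rV[R]_S) : Prop :=
  exists (Qt : 'rV[R]_S -> 'M[R]_S) (HR : borel_pts -> 'rV[R]_S),
    [/\ Q_ext Nbar N Qt, has_wmc V HR &
        forall z, GmN m Nbar N z -> HN z = HR z - Qcorr Qt z].

Definition condF (m : nat) (Nbar N : set 'rV[R]_S)
    (F : pts -> 'rV[R]_S -> R) : Prop :=
  let G := GmN m Nbar N in
  [/\ {within [set p : pts * 'rV[R]_S | G p.1], continuous (fun p => F p.1 p.2)},
      (forall z q, G z -> 0 <= F z q),
      (forall z q, G z -> (F z q = 0 <-> q = 0)),
      (forall z q1 q2 (t : R), G z -> 0 <= t <= 1 ->
          F z (t *: q1 + (1 - t) *: q2) <= t * F z q1 + (1 - t) * F z q2) &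
      exists phi : pts -> R -> R,
        [/\ {within [set p : pts * R | G p.1 /\ 0 <= p.2],
              continuous (fun p => phi p.1 p.2)},
            (forall z t, G z -> 0 <= t -> 0 <= phi z t),
            (forall z s t, G z -> 0 <= s -> s <= t -> phi z s <= phi z t),
            (forall z0, G z0 -> forall M : R, exists2 U, nbhs z0 U &
                exists T : R, forall z t, U z -> G z -> T <= t -> M <= phi z t) &
            (forall z q, G z -> phi z (enorm q) * enorm q <= F z q)]].

End Varifolds.

(* Main.v *)
Require Import Defs.
From HB Require Import structures.
From mathcomp Require Import all_boot all_order all_algebra.
From mathcomp Require Import all_classical all_reals all_analysis.
From mathcomp Require Import measurable_realfun ring lra.
Import Order.TTheory GRing.Theory Num.Theory.
Import numFieldNormedType.Exports.
Local Open Scope classical_set_scope.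
Local Open Scope ring_scope.

(** The chain (iii) => (ii) => (i) is immediate: use [F = |q|^2] with [Phi]
    linear, then test (ii) on a varifold with [H^N = 0].

    (i) => (iii) is a compactness argument.  On the compact bundle [G_m(N)] the
    relative mean curvature is characterised by
    [int (div_P X + Qcorr . X) dV = - int H^N . X dV], where [Qcorr] involves
    only derivatives of [Q] along tangent curves and so does not depend on the
    chosen extension.  If (iii) fails for [F], there are [V_k] with
    [k int F(H_k) dV_k < |V_k|].  Convexity and positivity of [F] give
    [|q| <= eps + C_eps F(z, q)], hence [int H_k . X dV_k = o(|V_k|)], and a
    weak limit of [V_k / |V_k|] is a probability varifold with [H^N = 0].

    The weak limit is obtained without Riesz representation: the limits along
    an ultrafilter of the masses of successively refined cells prescribe a
    subdivision of [[0, 1[] into nested intervals, which defines a Borel map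
    from [[0, 1[] to [G_m(N)]; the limit is the image of Lebesgue measure. *)

(** * Integrals of functions of bounded oscillation *)

Section bounded_oscillation.
Context {d : measure_display} {X : measurableType d} {R : realType}.
Variables (nu : {measure set X -> \bar R}) (D : set X) (g : X -> R) (c e : R).
Hypotheses (mD : measurable D) (finD : (nu D < +oo)%E) (mg : measurable_fun D g).
Hypothesis osc : forall x, D x -> `|g x - c| <= e.

Lemma bounded_osc_integrable : nu.-integrable D (EFin \o g).
Proof.
apply: measurable_bounded_integrable => //.
exists (`|c| + e); split; first by rewrite num_real.
move=> M hM x Dx /=; apply: le_trans (ltW hM).
by rewrite -[g x](subrK c) addrC (le_trans (ler_normD _ _))// lerD2l osc.
Qed.

(** Integrate |g - c| <= e. The estimate is used on both sides of the limit construction: for the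
    given measures on a cell, and for Lebesgue measure on the interval allotted to that cell. *)
Lemma Rintegral_osc :
  `|\int[nu]_(x in D) g x - c * fine (nu D)| <= e * fine (nu D).
Proof.
have ic (k : R) : nu.-integrable D (EFin \o cst k).
  apply: measurable_bounded_integrable => //; exists `|k|.
  by split=> [|M hM x _ /=]; [rewrite num_real | exact: ltW].
have ig := bounded_osc_integrable.
rewrite -(Rintegral_cst _ mD c) -(Rintegral_cst _ mD e).
rewrite -RintegralB//; last exact: ic.
apply: le_trans (le_normr_Rintegral _ _) _ => //.
  have -> : EFin \o (fun x => g x - c) = ((EFin \o g) \- (EFin \o cst c))%E.
    by apply/funext => x.
  by apply: integrableB => //; exact: ic.
apply: le_Rintegral => //; last exact: ic.
have -> : EFin \o (fun t => `|g t - c|) =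
    (abse \o ((EFin \o g) \- (EFin \o cst c)))%E.
  by apply/funext => x.
by apply: integrable_abse; apply: integrableB => //; exact: ic.
Qed.

End bounded_oscillation.

(** * Borel sets and functions on a normed space *)

Section borel.
Context {R : realType} {T : normedModType R}.
Local Notation B := (g_sigma_algebraType (@open T)).

Lemma open_borel (A : set T) : open A -> measurable (A : set B).
Proof. by move=> oA; exact: sub_sigma_algebra. Qed.

Lemma closed_borel (A : set T) : closed A -> measurable (A : set B).
Proof.
move=> cA; rewrite -[A]setCK; apply: measurableC; apply: open_borel.
exact: closed_openC.
Qed.

(** The preimage of an open interval is the trace on [K] of an open set of the ambient space, which
    is Borel because [K] is closed. *)
Lemma within_continuous_borel (K : set T) (f : T -> R) :
  closed K -> {within K, continuous f} -> measurable_fun (K : set B) f.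
Proof.
move=> cK /continuousP cf; apply: (measurability _ (RGenOpens.measurableE R)).
move=> _ [_ [a [b ->] <-]].
have /open_subspaceP[V oV VK] := cf _ (@interval_open _ (BRight a) (BLeft b) isT isT).
rewrite setIC -VK; apply: measurableI; [exact: open_borel|exact: closed_borel].
Qed.

End borel.

(** Compactness of [-M, M] gives a cluster point of the image filter. An ultrafilter contains the
    preimage of a neighbourhood or its complement, and clustering excludes the complement. *)
Lemma ultra_bounded_cvg (R : realType) (U : set_system nat) (u : nat -> R) (M : R) :
  UltraFilter U -> (forall k, `|u k| <= M) -> cvg (u @ U).
Proof.
move=> UU uM.
have : compact `[- M, M] by exact: segment_compact.
move=> /(_ (u @ U)) [|l [_ cl]].
  apply: (@filterS _ U _ setT) => [k _ /=|]; last exact: filterT.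
  by rewrite in_itv/= -ler_norml; exact: uM.
apply/cvg_ex; exists l => A Al.
have [//|UA] := in_ultra_setVsetC (u @^-1` A) UU.
by have [x [/= nAx Ax]] := cl (~` A) A UA Al.
Qed.

(** * Countable families of arbitrarily fine open sets *)

Section fine_covers.
Context {R : realType} {T : normedModType R}.

Lemma compact_finite_balls (K : set T) (e : R) : compact K -> 0 < e ->
  exists s : seq T, forall x, K x -> exists2 c, c \in s & ball c e x.
Proof.
move=> cK e0; rewrite compact_cover in cK.
have [|x Kx|D _ KD] := cK T K (fun c => (ball c e)^°).
- by move=> c _; exact: open_interior.
- by exists x => //; apply: nbhsx_ballx.
exists (finmap.enum_fset D) => x Kx.
by have [c /= cD /interior_subset cx] := KD x Kx; exists c.
Qed.

(** All balls of radius 1/(n+1) about a finite net of each level [n] are listed in one sequence.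
    Finiteness of each net makes the index bound [L] depend on [e] alone. *)
Lemma compact_fine_opens (K : set T) : compact K ->
  exists C : nat -> set T, (forall i, open (C i)) /\
    forall e : R, 0 < e -> exists L, forall x, K x -> exists i,
      [/\ (i < L)%N, C i x & forall y z, C i y -> C i z -> ball y e z].
Proof.
move=> cK.
have /choice[s hs] n : exists s : seq T, forall x, K x ->
    exists2 c, c \in s & ball c (n.+1%:R^-1 : R) x.
  exact: compact_finite_balls.
(* An index that codes no pair gives the empty set, and a [j] past the end of the net gives a ball
   about 0. Both are harmless: the conclusion only asks for some good index below [L]. *)
pose C i := if unpickle i is Some (n, j) then
  ball (nth 0 (s n) j) (n.+1%:R^-1 : R) else set0.
exists C; split.
  move=> i; rewrite /C; case: unpickle => [[n j]|]; last exact: open0.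
  by apply: ball_open.
move=> e e0.
have [n hn] : exists n : nat, n.+1%:R^-1 < e / 2.
  have e20 : 0 < e / 2 by rewrite divr_gt0.
  have [n _ /(_ n (leqnn n))] := near_infty_natSinv_lt (PosNum e20).
  by exists n.
exists (\max_(j < size (s n)) pickle (n, val j)).+1 => x Kx.
have [c cs cx] := hs n x Kx.
have js : (index c (s n) < size (s n))%N by rewrite index_mem.
exists (pickle (n, index c (s n))); rewrite /C pickleK nth_index//; split.
- by rewrite ltnS (@leq_bigmax _ (fun j => pickle (n, val j)) (Ordinal js)).
- by [].
- move=> y z cy cz; apply: (@ball_split _ _ c).
    by apply: ball_sym; apply: le_ball cy; exact: ltW.
  by apply: le_ball cz; exact: ltW.
Qed.

End fine_covers.

(** * Normalised integrals and their limits along an ultrafilter *)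

Section weak_limit.
Context {R : realType} {T : normedModType R}.
Local Notation B := (g_sigma_algebraType (@open T)).
Variables (K : set T) (mu : nat -> {measure set B -> \bar R}).
Hypothesis cptK : compact K.
Hypothesis mu_fin : forall k, (mu k setT < +oo)%E.
Hypothesis mu_gt0 : forall k, (0 < mu k setT)%E.
Hypothesis mu_out : forall k, mu k (~` K) = 0%E.
Variable U : set_system nat.
Hypothesis ultraU : UltraFilter U.

Let closedK : closed K.
Proof. by apply: compact_closed => //; exact: norm_hausdorff. Qed.

Let mK : measurable (K : set B). Proof. exact: closed_borel. Qed.

Definition bounded_borel (f : T -> R) :=
  measurable_fun (K : set B) f /\ exists M, forall z, K z -> `|f z| <= M.

Lemma continuous_bounded_borel (f : T -> R) :
  {within K, continuous f} -> bounded_borel f.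
Proof.
move=> cf; split; first exact: within_continuous_borel.
have /compact_bounded/ex_strict_bound_gt0[M _ /= hM] : compact (f @` K).
  exact: continuous_compact.
by exists M => z Kz; apply: ltW; apply: hM; exists z.
Qed.

Lemma cst_bounded_borel (c : R) : bounded_borel (cst c).
Proof. by split; [exact: measurable_cst | exists `|c|]. Qed.

Definition mean (f : T -> R) (A : set T) (k : nat) : R :=
  (\int[mu k]_(z in (A `&` K : set B)) f z) / fine (mu k setT).

(** The ultrafilter makes the limit exist for all bounded Borel [f] and Borel [A] at once. As a
    function of [A] it is only known to be finitely additive, which suffices for repeated
    subdivision; [w] below is the limit of the normalised masses. *)
Definition lmean f A : R := lim (mean f A @ U).

Local Notation w := (lmean (cst 1)).

Let mass_gt0 k : 0 < fine (mu k setT).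
Proof. by rewrite fine_gt0// mu_gt0 mu_fin. Qed.

Let measure_lty k (A : set B) : measurable A -> (mu k A < +oo)%E.
Proof.
move=> mA; apply: le_lt_trans (mu_fin k).
by apply: le_measure; rewrite ?inE//; exact: subsetT.
Qed.

Lemma mean1E (A : set B) k : measurable A ->
  mean (cst 1) A k = fine (mu k (A `&` K)) / fine (mu k setT).
Proof.
by move=> mA; rewrite /mean Rintegral_cst ?mul1r//; exact: measurableI.
Qed.

Lemma mean1_bounds (A : set B) k : measurable A -> 0 <= mean (cst 1) A k <= 1.
Proof.
move=> mA; rewrite mean1E// divr_ge0 ?fine_ge0//= ler_pdivrMr// mul1r fine_le//.
- by rewrite ge0_fin_numE//; apply: measure_lty; exact: measurableI.
- by rewrite ge0_fin_numE.
- by apply: le_measure => //; rewrite ?inE//; exact: measurableI.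
Qed.

Lemma mean_osc (f : T -> R) (A : set B) k (c e : R) :
  bounded_borel f -> measurable A ->
  (forall z, A z -> K z -> `|f z - c| <= e) ->
  `|mean f A k - c * mean (cst 1) A k| <= e * mean (cst 1) A k.
Proof.
move=> [mf _] mA h.
have mAK : measurable (A `&` K) by exact: measurableI.
have := @Rintegral_osc _ _ _ (mu k) (A `&` K) f c e mAK.
rewrite mean1E// /mean !mulrA -mulrBl normrM normfV.
rewrite [X in _ / X]gtr0_norm// ler_pM2r ?invr_gt0//; apply.
- exact: measure_lty.
- by apply: measurable_funS mf.
- by move=> z [Az Kz]; exact: h.
Qed.

Lemma mean_bound (f : T -> R) (M : R) (A : set B) k :
  bounded_borel f -> measurable A -> (forall z, K z -> `|f z| <= M) ->
  `|mean f A k| <= `|M|.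
Proof.
move=> bf mA fM.
have := @mean_osc f A k 0 `|M| bf mA; rewrite mul0r subr0 => /(_ _) h.
have /andP[w0 w1] := @mean1_bounds A k mA.
apply: le_trans (h _) _ => [z _ Kz|]; last by rewrite ler_piMr.
by rewrite subr0 (le_trans (fM _ Kz))// ler_norm.
Qed.

Lemma mean_split (f : T -> R) (A C : set B) k :
  bounded_borel f -> measurable A -> measurable C ->
  mean f A k = mean f (A `&` C) k + mean f (A `\` C) k.
Proof.
move=> [mf [M hM]] mA mC; rewrite /mean -mulrDl; congr (_ / _).
rewrite -Rintegral_setU.
- congr Rintegral; apply/seteqP; split => z /=.
    by case=> Az Kz; have [Cz|Cz] := pselect (C z); [left|right].
  by case=> -[[]].
- by apply: measurableI => //; exact: measurableI.
- by apply: measurableI => //; exact: measurableD.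
- apply: (@bounded_osc_integrable _ _ _ _ _ _ 0 M).
  + apply: measurableU; apply: measurableI => //; first exact: measurableI.
    exact: measurableD.
  + apply: measure_lty; apply: measurableU; apply: measurableI => //.
      exact: measurableI.
    exact: measurableD.
  + by apply: measurable_funS mf => // z [] [].
  + by move=> z [] [_ Kz]; rewrite subr0 hM.
- by rewrite disj_set2E; apply/eqP/seteqP; split => z //= [[[_ Cz] _] [[_ /(_ Cz)]]].
Qed.

Lemma lmean_cvg f (A : set B) : bounded_borel f -> measurable A ->
  mean f A @ U --> lmean f A.
Proof.
move=> bf mA; have [_ [M hM]] := bf.
apply: (@ultra_bounded_cvg _ _ _ `|M|) => // k.
exact: mean_bound.
Qed.

Lemma lmean_split f (A C : set B) : bounded_borel f -> measurable A -> measurable C ->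
  lmean f A = lmean f (A `&` C) + lmean f (A `\` C).
Proof.
move=> bf mA mC; apply/cvg_lim => //.
have -> : mean f A = fun k => mean f (A `&` C) k + mean f (A `\` C) k.
  by apply/funext => k; exact: mean_split.
by apply: cvgD; apply: lmean_cvg => //; [exact: measurableI|exact: measurableD].
Qed.

(** The non-strict inequality of [mean_osc] passes to the limit. It ties [lmean f] to the weights
    [w] although neither is yet an integral against a measure. *)
Lemma lmean_osc (f : T -> R) (A : set B) (c e : R) :
  bounded_borel f -> measurable A ->
  (forall z, A z -> K z -> `|f z - c| <= e) ->
  `|lmean f A - c * w A| <= e * w A.
Proof.
move=> bf mA h.
have cw : mean (cst 1) A @ U --> w A by apply: lmean_cvg => //; exact: cst_bounded_borel.
have cl : (fun k => `|mean f A k - c * mean (cst 1) A k|) @ U -->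
    `|lmean f A - c * w A|.
  by apply: cvg_norm; apply: cvgB; [exact: lmean_cvg | exact: cvgMr].
have cr : (fun k => e * mean (cst 1) A k) @ U --> e * w A by exact: cvgMr.
apply: ler_cvg_to cl cr _; apply: (@filterS _ U _ setT) => [k _|]; last exact: filterT.
exact: mean_osc.
Qed.

Lemma weight_ge0 (A : set B) : measurable A -> 0 <= w A.
Proof.
move=> mA.
have cw : mean (cst 1) A @ U --> w A by apply: lmean_cvg => //; exact: cst_bounded_borel.
apply: (ler_cvg_to (cvg_cst 0) cw).
apply: (@filterS _ U _ setT) => [k _|]; last exact: filterT.
by have /andP[] := @mean1_bounds A k mA.
Qed.

Lemma weight_empty (A : set B) : A `&` K = set0 -> w A = 0.
Proof.
move=> A0; apply/cvg_lim => //.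
have -> : mean (cst 1) A = fun=> 0.
  by apply/funext => k; rewrite /mean A0 Rintegral_set0 mul0r.
exact: cvg_cst.
Qed.

Lemma weightT : w setT = 1.
Proof.
apply/cvg_lim => //; have -> : mean (cst 1) setT = fun=> 1; last exact: cvg_cst.
apply/funext => k; rewrite mean1E// setTI.
have : mu k setT = mu k K.
  rewrite -[X in mu k X = _](setUv (K : set B)) measureU//.
  - by rewrite -[RHS]adde0; congr (_ + _)%E; exact: mu_out.
  - exact: measurableC.
  - by rewrite setICr.
by move=> <-; rewrite divff// gt_eqF.
Qed.

End weak_limit.

(** Compactness is used in its near-covering form: a property that holds near each point of [K] for
    all small [r] holds on all of [K] for small [r]. *)
Lemma compact_within_unif_continuous (R : realType) (T : normedModType R)
    (K : set T) (f : T -> R) (e : R) :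
  compact K -> {within K, continuous f} -> 0 < e ->
  exists2 r : R, 0 < r &
    forall x y, K x -> K y -> ball x r y -> `|f x - f y| <= e.
Proof.
move=> /compact_near_coveringP cK /subspace_continuousP cf e0.
have e20 : 0 < e / 2 by rewrite divr_gt0.
pose P (r : R) x := K x -> forall y, K y -> ball x r y -> `|f x - f y| <= e.
have : \forall r \near (0 : R)^'+, K `<=` P r.
  apply: cK => x Kx.
  have /cvgrPdist_lt/(_ _ e20)/nbhs_ballP[r /= r0 hr] := cf x Kx.
  (* With the radius of continuity at [x] halved, both [x'] and any [y] within [s] of it stay within
     [r] of [x]. *)
  have r20 : 0 < r / 2 by rewrite divr_gt0.
  exists (ball x (r / 2), [set s | 0 < s < r / 2]) => /=.
    split; first exact: nbhsx_ballx.
    near=> s; apply/andP; split; near: s; first exact: nbhs_right_gt.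
    exact: nbhs_right_lt.
  move=> [x' s] /= [xx' /andP[s0 sr]] Kx' y Ky x'y.
  have h1 : `|f x - f x'| < e / 2.
    by apply: hr => //; apply: le_ball xx'; lra.
  have h2 : `|f x - f y| < e / 2.
    by apply: hr => //; apply: ball_split xx' (le_ball (ltW sr) x'y).
  rewrite -(subrK (f x) (f x')) -addrA (le_trans (ler_normD _ _))// [e]splitr.
  by rewrite lerD// ltW// distrC.
move=> h; near (0 : R)^'+ => r.
exists r; first by near: r; exact: nbhs_right_gt.
have : K `<=` P r by near: r.
by move=> hP x y Kx Ky; exact: hP.
Unshelve. all: by end_near. Qed.

Lemma measurable_prop (d : measure_display) (X : measurableType d) (P : Prop) :
  measurable [set _ : X | P].
Proof.
have [p|np] := pselect P.
  by rewrite (_ : mkset _ = setT)//; apply/seteqP; split.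
by rewrite (_ : mkset _ = set0)//; apply/seteqP; split.
Qed.

(** * The cell map from the unit interval to a compact set *)

Section cell_map.
Context {R : realType} {T : normedModType R}.
Local Notation B := (g_sigma_algebraType (@open T)).
Variables (K : set T) (w : set B -> R) (C : nat -> set T).
Hypothesis cptK : compact K.
Hypothesis w_ge0 : forall A : set B, measurable A -> 0 <= w A.
Hypothesis w_split : forall A D : set B, measurable A -> measurable D ->
  w A = w (A `&` D) + w (A `\` D).
Hypothesis w_empty : forall A : set B, A `&` K = set0 -> w A = 0.
Hypothesis wT : w setT = 1.
Hypothesis openC : forall i, open (C i).
Hypothesis fineC : forall e : R, 0 < e -> exists L, forall x, K x -> exists i,
  [/\ (i < L)%N, C i x & forall y z, C i y -> C i z -> ball y e z].

Let mC i : measurable (C i : set B). Proof. exact: open_borel. Qed.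

(* A state [(A, lo)] stands for the cell [A], to which the subinterval
   [lo, lo + w A[ of the unit interval is allotted. *)
Definition cell_step (i : nat) (t : R) (s : set B * R) : set B * R :=
  if t < s.2 + w (s.1 `&` C i) then (s.1 `&` C i, s.2)
  else (s.1 `\` C i, s.2 + w (s.1 `&` C i)).

Fixpoint cell (t : R) (l : nat) : set B * R :=
  if l is l'.+1 then cell_step l' t (cell t l') else (setT, 0).

(** At a fixed state, one step splits the line at a single threshold. Letting [Q] depend on both the
    state and [t] allows that threshold to be absorbed into [Q], so the induction closes. *)
Lemma measurable_cell l (Q : set B * R -> set R) :
  (forall s, measurable (Q s)) -> measurable [set t | Q (cell t l) t].
Proof.
elim: l Q => [|l IH] Q mQ; first exact: mQ.
pose Q' s := [set t | Q (cell_step l t s) t].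
apply: (IH Q') => s; rewrite /Q' /cell_step.
set b := s.2 + _; set s0 := (_, s.2); set s1 := (_, b).
have -> : [set t | Q (if t < b then s0 else s1) t] =
    (`]-oo, b[ `&` Q s0) `|` (`[b, +oo[ `&` Q s1).
  apply/seteqP; split => t /=; rewrite !in_itv/= andbT.
    by case: ltP => tb Qt; [left|right].
  by case=> -[tb Qt]; case: ltP tb.
by apply: measurableU; apply: measurableI.
Qed.

Lemma measurable_cell_set t l : measurable (cell t l).1.
Proof.
elim: l => [|l IH] /=; first exact: measurableT.
by rewrite /cell_step; case: ifP => _ /=; [exact: measurableI|exact: measurableD].
Qed.

(** A step cuts the interval allotted to [A] at lo + w (A [&] C i), and [w_split] makes the second
    piece end where the old interval ended. *)
Lemma cell_bounds t l : 0 <= t < 1 ->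
  (cell t l).2 <= t < (cell t l).2 + w (cell t l).1.
Proof.
move=> t01; elim: l => [|l /andP[IH1 IH2]] /=; first by rewrite wT add0r.
rewrite /cell_step; case: ltP => /= tb; first by rewrite IH1.
by rewrite -addrA -w_split// ?tb//; exact: measurable_cell_set.
Qed.

(** The allotted interval contains [t], so it has positive length and the cell cannot miss [K]. *)
Lemma cell_nonempty t l : 0 <= t < 1 -> (cell t l).1 `&` K !=set0.
Proof.
move=> /cell_bounds-/(_ l)/andP[h1 h2]; apply/set0P/eqP => /w_empty w0.
by move: h2; rewrite w0 addr0 ltNge h1.
Qed.

Lemma cell_nested t l k : (cell t (l + k)%N).1 `<=` (cell t l).1.
Proof.
elim: k => [|k IH]; first by rewrite addn0.
apply: subset_trans IH; rewrite addnS /= /cell_step.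
by case: ifP => _ z [].
Qed.

Lemma cell_decided t l i : (i < l)%N ->
  (cell t l).1 `<=` C i \/ (cell t l).1 `<=` ~` C i.
Proof.
elim: l => [//|l IH]; rewrite ltnS leq_eqVlt => /predU1P[->|/IH h] /=.
  by rewrite /cell_step; case: ifP => _; [left|right] => z [].
have sub : (cell_step l t (cell t l)).1 `<=` (cell t l).1.
  by rewrite /cell_step; case: ifP => _ z [].
by case: h => h; [left|right]; exact: subset_trans h.
Qed.

(** By level [L] the cell lies inside or outside each [C i] with i < L. A small [C i] containing the
    point [x] of the cell must therefore contain the whole cell. *)
Lemma cell_small (e : R) : 0 < e -> exists L, forall t x y,
  (cell t L).1 x -> K x -> (cell t L).1 y -> ball x e y.
Proof.
move=> /fineC[L hL]; exists L => t x y Ax Kx Ay.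
have [i [iL Cx hC]] := hL x Kx.
have [AC|AC] := cell_decided t L i iL; last by have := AC _ Ax.
by apply: hC => //; exact: AC.
Qed.

(** Pick a point of [K] in each cell; a cluster point of this sequence works since the cells are
    nested. Cells need not be closed, hence the closures. *)
Lemma cell_point t : 0 <= t < 1 ->
  exists x, K x /\ forall l, closure ((cell t l).1 `&` K) x.
Proof.
move=> t01.
have /choice[p hp] l : exists x, ((cell t l).1 `&` K) x.
  exact: cell_nonempty.
have [|x [Kx cx]] := @cptK (p @ \oo) _.
  by exists 0%N => // l _; case: (hp l).
exists x; split=> // l N Nx; apply: cx => //.
exists l => // k /= lk; have [Ak Kk] := hp k; split => //.
by move: Ak; rewrite -(subnKC lk) => /cell_nested.
Qed.

Lemma cell_map_exists : exists tau : R -> T,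
  [/\ forall t, K (tau t),
      forall t, 0 <= t < 1 -> forall l, closure ((cell t l).1 `&` K) (tau t) &
      measurable_fun setT (tau : measurableTypeR R -> B)].
Proof.
have t00 : 0 <= (0 : R) < 1 by rewrite lexx ltr01.
have [p0 [Kp0 _]] := cell_point _ t00.
(* Outside [0, 1[ the map takes the constant value [p0], which keeps all its values in [K] and does
   not affect measurability. *)
have /choice[tau htau] (t : R) : exists x : T, [/\ K x,
    0 <= t < 1 -> forall l, closure ((cell t l).1 `&` K) x &
    ~~ (0 <= t < 1) -> x = p0].
  have [t01|t01] := boolP (0 <= t < 1).
    by have [x [Kx hx]] := cell_point _ t01; exists x; split.
  by exists p0; split.
have hK t : K (tau t) by case: (htau t).
have hcl t : 0 <= t < 1 -> forall l, closure ((cell t l).1 `&` K) (tau t).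
  by case: (htau t).
have hp t : ~~ (0 <= t < 1) -> tau t = p0 by case: (htau t).
exists tau; split=> //.
apply: (@measurability _ _ _ B setT tau (@open T)) => //.
move=> _ [V oV <-]; rewrite setTI.
pose Q (s : set B * R) : set R :=
  [set t | closure (s.1 `&` K) `<=` V].
(* Since the cells shrink to [tau t], this point lies in the open set [V] exactly when some cell of
   [t] has its closure in [V]. That condition depends on the state alone, so [measurable_cell]
   applies. *)
have -> : tau @^-1` V =
    (`[0, 1[ `&` \bigcup_l [set t | Q (cell t l) t]) `|`
    (~` `[0, 1[ `&` [set t | V p0]).
  apply/seteqP; split=> t /=; rewrite in_itv/=.
    have [t01 Vt|/hp -> Vp] := boolP (0 <= t < 1); last by right.
    left; split => //.
    have : nbhs (tau t) V by exact: open_nbhs_nbhs.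
    move=> /nbhs_ballP[e /= e0 eV].
    (* Both [tau t] and [y] are within e / 3 of points of the cell in [K], and those two points are
       within e / 3 of each other. *)
    have e30 : 0 < e / 3 by rewrite divr_gt0.
    have [L hL] := cell_small _ e30.
    exists L => //= y cly; apply: eV.
    have [x' [[Ax' Kx'] bxx]] := hcl t t01 L _ (nbhsx_ballx _ _ e30).
    have [y' [[Ay' Ky'] byy]] := cly _ (nbhsx_ballx _ _ e30).
    rewrite (_ : e = e / 3 + e / 3 + e / 3); last lra.
    apply: ball_triangle (ball_sym byy).
    by apply: ball_triangle bxx _; exact: (hL t).
  case=> [[t01 [l _ /= h]]|[/negP/hp -> //]].
  by apply: h; exact: hcl.
apply: measurableU; apply: measurableI => //.
- apply: bigcup_measurable => l _; apply: measurable_cell => s.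
  exact: measurable_prop.
- exact: measurableC.
- exact: measurable_prop.
Qed.

(** * Integration along the cell map *)

Variables (f : T -> R) (lam : set B -> R).
Hypothesis contf : {within K, continuous f}.
Hypothesis lam_split : forall A D : set B, measurable A -> measurable D ->
  lam A = lam (A `&` D) + lam (A `\` D).
Hypothesis lam_osc : forall (A : set B) (c e : R), measurable A ->
  (forall z, A z -> K z -> `|f z - c| <= e) -> `|lam A - c * w A| <= e * w A.
Variables (nu : {measure set (measurableTypeR R) -> \bar R}) (tau : R -> T).
Hypothesis nu_fin : (nu setT < +oo)%E.
Hypothesis nu_itv : forall a b : R, 0 <= a -> 0 <= b -> a + b <= 1 ->
  nu `[a, a + b[%classic = b%:E.
Hypothesis tauK : forall t, K (tau t).
Hypothesis tau_cell : forall t, 0 <= t < 1 ->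
  forall l, closure ((cell t l).1 `&` K) (tau t).
Hypothesis mtau : measurable_fun setT (fun t : measurableTypeR R => f (tau t)).

(** Induction on the number [j] of subdivisions left before level [L]. At level [L], the integral
    and [lam A] are each within e * w A of f c * w A for a point [c] of the cell, whence e + e;
    before that, both sides are additive under the next subdivision. *)
Lemma cell_itv_integral (e : R) L :
  (forall t x y, (cell t L).1 x -> K x -> (cell t L).1 y -> K y ->
     `|f x - f y| <= e) ->
  forall j l A lo, (l + j)%N = L -> measurable A -> 0 <= lo -> lo + w A <= 1 ->
  (forall t, lo <= t < lo + w A -> cell t l = (A, lo)) ->
  `|\int[nu]_(t in `[lo, lo + w A[%classic) f (tau t) - lam A| <= (e + e) * w A.
Proof.
have [M fM] : exists M, forall z, K z -> `|f z| <= M.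
  have /compact_bounded/ex_strict_bound_gt0[M _ /= hM] : compact (f @` K).
    exact: continuous_compact.
  by exists M => z Kz; apply: ltW; apply: hM; exists z.
move=> hL; elim=> [|j IH] l A lo lL mA lo0 lo1 hA.
  rewrite addn0 in lL; rewrite {}lL in hA.
  have := w_ge0 _ mA; rewrite le_eqVlt => /predU1P[w0|w0].
    (* The interval is empty, and [lam A] vanishes because |lam A| <= M * w A. *)
    have := @lam_osc A 0 M mA.
    rewrite -w0 addr0 !mulr0 subr0 set_itvco0 Rintegral_set0 sub0r normrN; apply.
    by move=> z _ Kz; rewrite subr0 fM.
  have t01 t : lo <= t < lo + w A -> 0 <= t < 1 by lra.
  have lot : lo <= lo < lo + w A by rewrite lexx ltrDl.
  have [c []] := cell_nonempty _ L (t01 _ lot); rewrite hA//= => Ac Kc.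
  have hz z : A z -> K z -> `|f z - f c| <= e.
    by move=> Az Kz; apply: (hL lo); rewrite ?hA.
  have ht t : `[lo, lo + w A[%classic t -> `|f (tau t) - f c| <= e.
    rewrite /= in_itv/= => tI.
    have := tau_cell _ (t01 _ tI) L; rewrite hA//= => cl.
    (* [tau t] lies only in the closure of the cell, so it is compared with a point [z] of the cell
       in [K] where [f] differs by less than [h]. *)
    apply/ler_addgt0Pl => h h0.
    have /subspace_continuousP/(_ _ (tauK t))/cvgrPdist_lt/(_ h h0) := contf.
    move=> /cl[z [[Az Kz] /(_ Kz) hzt]].
    rewrite -(subrK (f z) (f (tau t))) -addrA (le_trans (ler_normD _ _))//.
    by rewrite lerD ?hz// ltW.
  have wnu := nu_itv _ _ lo0 (ltW w0) lo1.
  have := @Rintegral_osc _ _ _ nu `[lo, lo + w A[%classic (fun t => f (tau t)) (f c) e.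
  rewrite wnu/= => /(_ _ _ _ ht) h1.
  have h2 := lam_osc _ _ _ mA hz.
  have {}h1 := h1 (measurable_itv _) (ltry _) (measurable_funS _ _ mtau).
  rewrite -(subrK (f c * w A) (\int[nu]_(_ in _) _)) -addrA.
  rewrite (le_trans (ler_normD _ _))// mulrDl lerD//; last by rewrite distrC.
  exact: h1.
have mA0 : measurable (A `&` C l) by exact: measurableI.
have mA1 : measurable (A `\` C l) by exact: measurableD.
have wE := w_split _ _ mA (mC l).
have w00 := w_ge0 _ mA0; have w10 := w_ge0 _ mA1.
have r0 t : lo <= t < lo + w (A `&` C l) -> cell t l.+1 = (A `&` C l, lo).
  move=> /andP[t1 t2]; rewrite /= hA /cell_step/= ?t2//.
  by rewrite t1 wE (lt_le_trans t2)// lerD2l lerDl.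
have r1 t : lo + w (A `&` C l) <= t < lo + w (A `&` C l) + w (A `\` C l) ->
    cell t l.+1 = (A `\` C l, lo + w (A `&` C l)).
  move=> /andP[t1 t2]; rewrite /= hA; first by rewrite /cell_step/= ltNge t1.
  by rewrite wE addrA t2 andbT (le_trans _ t1)// lerDl.
have h0 := IH l.+1 (A `&` C l) lo.
have h1 := IH l.+1 (A `\` C l) (lo + w (A `&` C l)).
rewrite addSnnS in h0 h1.
have {}h0 : `|\int[nu]_(t in `[lo, lo + w (A `&` C l)[%classic) f (tau t) - lam (A `&` C l)|
    <= (e + e) * w (A `&` C l).
  by apply: h0 => //; apply: le_trans lo1; rewrite wE lerD2l lerDl.
have {}h1 : `|\int[nu]_(t in `[lo + w (A `&` C l), lo + w (A `&` C l) + w (A `\` C l)[%classic)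
      f (tau t) - lam (A `\` C l)| <= (e + e) * w (A `\` C l).
  by apply: h1 => //; [rewrite addr_ge0|rewrite -addrA -wE].
rewrite (lam_split _ _ mA (mC l)) wE mulrDr.
have -> : `[lo, lo + (w (A `&` C l) + w (A `\` C l))[%classic =
   `[lo, lo + w (A `&` C l)[ `|`
   `[lo + w (A `&` C l), lo + w (A `&` C l) + w (A `\` C l)[ :> set R.
  by rewrite addrA; apply: itv_bndbnd_setU; rewrite bnd_simp lerDl.
rewrite Rintegral_setU//.
- rewrite opprD addrACA (le_trans (ler_normD _ _))//.
  exact: lerD.
- apply: (@bounded_osc_integrable _ _ _ _ _ _ 0 M).
  + exact: measurableU.
  + apply: le_lt_trans nu_fin; apply: le_measure => //; rewrite inE//.
    exact: measurableU.
  + exact: measurable_funS mtau.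
  + by move=> t _; rewrite subr0 fM.
- rewrite disj_set2E; apply/eqP/seteqP; split => t //=; rewrite !in_itv/=.
  by case=> /andP[_ ta] /andP[]; rewrite leNgt ta.
Qed.

(** Apply the estimate to the undivided interval, whose weight is 1; uniform continuity and
    [cell_small] make the error arbitrarily small. *)
Lemma cell_map_integral : \int[nu]_(t in `[0, 1[%classic) f (tau t) = lam setT.
Proof.
apply/eqP; rewrite -subr_eq0 -normr_le0; apply/ler_addgt0Pl => e e0.
have e20 : 0 < e / 2 by rewrite divr_gt0.
have [r r0 hr] := compact_within_unif_continuous _ _ _ _ _ cptK contf e20.
have [L hL] := cell_small _ r0.
have := @cell_itv_integral (e / 2) L _ L 0%N setT 0 erefl measurableT (lexx 0).
rewrite wT add0r mulr1 addr0 -splitr; apply=> //.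
by move=> t x y Ax Kx Ay Ky; apply: hr => //; exact: (hL t).
Qed.

End cell_map.

(** * Existence of a weak limit *)

Lemma pushforward_exists (d1 d2 : measure_display) (X : measurableType d1)
    (Y : measurableType d2) (R : realType) (mu : {measure set X -> \bar R})
    (phi : X -> Y) : measurable_fun setT phi ->
  exists V : {measure set Y -> \bar R},
    (forall A, V A = mu (phi @^-1` A)) /\
    forall f : Y -> R, measurable_fun setT f ->
      mu.-integrable setT (EFin \o (f \o phi)) ->
      \int[V]_y f y = \int[mu]_x f (phi x).
Proof.
move=> mphi.
pose V : {measure set Y -> \bar R} :=
  measure_function_pushforward__canonical__measure_function_Measure mu mphi.
exists V; split=> // f mf intf; rewrite /Rintegral.
have := @integral_pushforward _ _ _ _ _ phi mphi mu setT (EFin \o f).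
by rewrite preimage_setT => ->//; exact/measurable_EFinP.
Qed.

Lemma unit_itv_measure (R : realType) : exists nu : {measure set (measurableTypeR R) -> \bar R},
  [/\ nu setT = 1%E, nu (~` `[0, 1[%classic) = 0%E &
      forall a b : R, 0 <= a -> 0 <= b -> a + b <= 1 ->
        nu `[a, a + b[%classic = b%:E].
Proof.
have mI : measurable (`[0, 1[%classic : set (measurableTypeR R)) by exact: measurable_itv.
exists (mrestr lebesgue_measure mI); split.
- by rewrite /= /mrestr setTI lebesgue_measure_itv/= lte01 sube0.
- by rewrite /= /mrestr setICl measure0.
- move=> a b a0 b0 ab; rewrite /= /mrestr.
  have -> : `[a, a + b[ `&` `[0, 1[ = `[a, a + b[%classic :> set R.
    by apply: setIidl => t /=; rewrite !in_itv/=; lra.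
  rewrite lebesgue_measure_itv/= lte_fin ltrDl.
  have [b1|] := ltP 0 b; first by rewrite -EFinB addrC addKr.
  by move=> b1; congr EFin; lra.
Qed.

(** [V] is chosen before [f], as the image of Lebesgue measure on [0, 1[ under the cell map; its
    integral of [f] is the ultrafilter limit of the normalised integrals. *)
Lemma weak_limit_point (R : realType) (T : normedModType R) (K : set T)
    (mu : nat -> {measure set (g_sigma_algebraType (@open T)) -> \bar R}) :
  compact K ->
  (forall k, (mu k setT < +oo)%E) -> (forall k, (0 < mu k setT)%E) ->
  (forall k, mu k (~` K) = 0%E) ->
  exists V : {measure set (g_sigma_algebraType (@open T)) -> \bar R},
    [/\ V setT = 1%E, V (~` K) = 0%E &
        forall (f : T -> R) (c : R), {within K, continuous f} ->
          (fun k => (\int[mu k]_(z in K) f z) / fine (mu k setT)) @ \oo --> c ->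
          \int[V]_(z in K) f z = c].
Proof.
move=> cK mufin mugt muK; set B := g_sigma_algebraType (@open T) in mu mufin mugt muK *.
have [U [UU sU]] := ultraFilterLemma eventually_filter.
have [C [oC fC]] := compact_fine_opens _ cK.
have [nu [nuT nuo nui]] := unit_itv_measure R.
pose lm := lmean K mu U.
pose w := lm (cst 1).
have wge0 (A : set B) : measurable A -> 0 <= w A by exact: weight_ge0.
have bb1 : bounded_borel K (cst 1) by exact: cst_bounded_borel.
have wsp (A D : set B) : measurable A -> measurable D -> w A = w (A `&` D) + w (A `\` D).
  exact: lmean_split.
have we (A : set B) : A `&` K = set0 -> w A = 0 by exact: weight_empty.
have wT : w setT = 1 by exact: weightT.
have [tau [tauK taucl mtau]] := cell_map_exists K w C cK wsp we wT oC fC.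
have clK : closed K by apply: compact_closed => //; exact: norm_hausdorff.
have mK : measurable (K : set B) by exact: closed_borel.
have mI : measurable (`[0, 1[%classic : set (measurableTypeR R)) by exact: measurable_itv.
have nufin : (nu setT < +oo)%E by rewrite nuT ltry.
have [V [VE Vint]] := pushforward_exists _ _ _ _ _ nu (tau : measurableTypeR R -> B) mtau.
exists V; split.
- by rewrite VE preimage_setT.
- rewrite VE (_ : _ @^-1` _ = set0) ?measure0//.
  by apply/seteqP; split => t //= /(_ (tauK t)).
move=> f c cf cvgc.
have bf := continuous_bounded_borel K cK f cf.
have [mf [M fM]] := bf.
(* [f] is known to be Borel only on [K]; its extension by zero is Borel everywhere and agrees with
   [f] along [tau]. *)
have mfT : measurable_fun setT ((f \_ K) : B -> R).
  by apply/(measurable_restrictT _ _).1.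
have fK t : (f \_ K) (tau t) = f (tau t) by rewrite patchE mem_set.
have mft : measurable_fun setT (fun t : measurableTypeR R => f (tau t)).
  under eq_fun do rewrite -fK.
  exact: (measurableT_comp mfT).
have ift : nu.-integrable setT (EFin \o (fun t => f (tau t))).
  by apply: (@bounded_osc_integrable _ _ _ nu setT _ 0 M) => // t _; rewrite subr0 fM.
have -> : \int[V]_(z in K) f z = \int[nu]_t f (tau t).
  rewrite Rintegral_mkcond Vint//.
    by apply: eq_Rintegral => t _; exact: fK.
  by apply: eq_integrable ift => // t _ /=; rewrite fK.
have -> : \int[nu]_t f (tau t) = \int[nu]_(t in `[0, 1[%classic) f (tau t).
  rewrite -{1}(setUv `[0, 1[%classic) Rintegral_setU//.
  - rewrite [X in _ + X](_ : _ = 0) ?addr0//.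
    rewrite /Rintegral null_set_integral//; first exact: measurableC.
    by apply/measurable_EFinP; exact: measurable_funS mft.
  - exact: measurableC.
  - by rewrite setUv.
  - by rewrite disj_set2E setICr.
rewrite (@cell_map_integral _ _ K w C cK wge0 wsp we wT oC fC f (lm f) cf _ _ nu tau)//.
(* The ultrafilter refines the filter of eventual sets, so it has the same limit [c]. *)
- apply/cvg_lim => //.
  rewrite (_ : mean K mu f setT = fun k => (\int[mu k]_(z in K) f z) / fine (mu k setT)).
    by move=> A /cvgc/sU.
  by apply/funext => k; rewrite /mean setTI.
- by move=> A D; exact: lmean_split.
- by move=> A d e; exact: lmean_osc.
Qed.

(** * Projection matrices *)

(** Factor [P] through its row and column bases and commute the trace. This turns the rank condition
    on a projection into a continuous equation, used for closedness of the bundle. *)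
Lemma mxtrace_idempotent (F : fieldType) (n : nat) (P : 'M[F]_n) :
  P *m P = P -> \tr P = (\rank P)%:R.
Proof.
move=> PP; have RC : row_base P *m col_base P = 1%:M.
  apply: (row_free_inj (row_base_free P)); apply: (row_full_inj (col_base_full P)).
  by rewrite mul1mx -mulmxA mulmxA !mulmx_base.
by rewrite -[X in \tr X]mulmx_base mxtrace_mulC RC mxtrace1.
Qed.

Section projections.
Context {R : realType} {S : nat}.
Implicit Types P A : 'M[R]_S.

(** Equal ranges give AB = A and BA = B; transposing the first gives BA = A. *)
Lemma orth_proj_unique A B (W : set 'rV[R]_S) :
  orth_proj A W -> orth_proj B W -> A = B.
Proof.
move=> [At AA AW] [Bt BB BW].
have fixA (C D : 'M[R]_S) : C *m C = C ->
    (forall v : 'rV[R]_S, v *m C = v -> v *m D = v) -> C *m D = C.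
  move=> CC h; apply/row_matrixP => i; rewrite row_mul h//.
  by rewrite -row_mul CC.
have AB : A *m B = A by apply: fixA => // v /AW/BW.
have BA : B *m A = B by apply: fixA => // v /BW/AW.
by rewrite -At -{1}AB trmx_mul At Bt BA.
Qed.

(** The diagonal entry P_ii is the sum of the squares P_ik^2. Hence P_ii <= 1, and every P_ij^2 is
    at most P_ii. *)
Lemma symmetric_idempotent_entry P i j : P^T = P -> P *m P = P -> `|P i j| <= 1.
Proof.
move=> Pt PP.
have Pki l : P l i = P i l by rewrite -{1}Pt mxE.
have sq k : P i k ^+ 2 <= P i i.
  have := congr1 (fun M : 'M[R]_S => M i i) PP; rewrite mxE => <-.
  rewrite (bigD1 k)//= (Pki k) -expr2 lerDl.
  by apply: sumr_ge0 => l _; rewrite (Pki l) -expr2 sqr_ge0.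
have Pii : P i i <= 1.
  have := sq i; have [->//|P0] := eqVneq (P i i) 0.
  have : 0 < P i i by rewrite lt0r P0 (le_trans (sqr_ge0 _) (sq i)).
  nra.
by rewrite -(@expr_le1 _ 2%N) ?real_normK ?num_real// (le_trans (sq j)).
Qed.

Lemma compact_matrix_box (m n : nat) (M : R) :
  compact [set P : 'M[R]_(m, n) | forall i j, `|P i j| <= M].
Proof.
have cbox : compact [set v : 'rV[R]_(m * n) | forall i, `[- M, M]%classic (v ord0 i)].
  by apply: (@rV_compact _ _ (fun=> `[- M, M]%classic)) => _; exact: segment_compact.
have vc : continuous (vec_mx : 'rV[R]_(m * n) -> 'M[R]_(m, n)).
  move=> v; apply/(@cvg_ballP _ _ _ _ (nbhs_filter v)) => e e0.
  apply: filterS (nbhsx_ballx v _ e0) => u [_ vu]; split=> // i j.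
  by rewrite !mxE; exact: vu.
have := @continuous_compact _ _ vec_mx _ (continuous_subspaceT vc) cbox.
congr compact; apply/seteqP; split => [_ [v hv <-] i j|P hP /=].
  by rewrite mxE; have := hv (mxvec_index i j); rewrite /= in_itv/= -ler_norml.
exists (mxvec P); last exact: mxvecK.
by move=> k; case/mxvec_indexP: k => i j; rewrite mxvecE /= in_itv/= -ler_norml.
Qed.

End projections.

(** * Continuity and derivatives of matrix entries *)

Section pointwise_continuity.
Context {R : realType}.

Lemma cvg_fsum {T : Type} (F : set_system T) {FF : Filter F} (I : finType)
    (f : I -> T -> R) (l : I -> R) :
  (forall i, f i @ F --> l i) -> (fun x => \sum_i f i x) @ F --> \sum_i l i.
Proof. by move=> h; apply: cvg_big => // x; exact: add_continuous. Qed.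

Lemma eq0_on_closure (T : topologicalType) (A : set T) (f : T -> R) z :
  closure A z -> f @ z --> f z -> (forall x, A x -> f x = 0) -> f z = 0.
Proof.
move=> Az fz f0; apply/eqP; rewrite -normr_le0; apply/ler_addgt0Pl => e e0.
move/cvgrPdist_lt: fz => /(_ e e0)/Az[x [Ax]] /=.
by rewrite (f0 x Ax) subr0 addr0 => /ltW.
Qed.

Lemma cvg_entry (T : topologicalType) (m n : nat) (f : T -> 'M[R]_(m, n)) z i j :
  f @ z --> f z -> (fun x => f x i j) @ z --> f z i j.
Proof.
move=> fz; apply: (@cvg_comp _ _ _ f (fun M : 'M[R]_(m, n) => M i j) _ _ _ fz).
exact: coord_continuous.
Qed.

Lemma derive_entry (V : normedModType R) (m n : nat) (f : V -> 'M[R]_(m, n)) x v i j :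
  differentiable f x -> 'D_v (fun y => f y i j) x = ('D_v f x) i j.
Proof. by move=> /(diff_derivable (v := v))/derive_mx ->; rewrite mxE. Qed.

Lemma differentiable_entry (V : normedModType R) (m n : nat)
    (f : V -> 'M[R]_(m, n)) x i j :
  differentiable f x -> differentiable (fun y => f y i j) x.
Proof.
move=> df; apply: (@differentiable_comp _ _ _ _ f (fun M : 'M[R]_(m, n) => M i j)) => //.
exact: differentiable_coord.
Qed.

End pointwise_continuity.

(** * The bundle of tangent planes and the curvature correction *)

Section grassmann_bundle.
Context {R : realType} {S : nat}.
Variables (m : nat) (Nbar N : set 'rV[R]_S).
Hypotheses (NNbar : N `<=` Nbar) (cptN : compact N).
Local Notation G := (GmN m Nbar N).

Lemma Q_ext_proj Qt x : Q_ext Nbar N Qt -> N x -> orth_proj (Qt x) (tangent Nbar x).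
Proof. by move=> [W [_ NW h _ _]] Nx; apply: h; [exact: NW|exact: NNbar]. Qed.

Lemma Q_ext_differentiable Qt x : Q_ext Nbar N Qt -> N x -> differentiable Qt x.
Proof. by move=> [W [_ NW _ h _]] Nx; apply: h; exact: NW. Qed.

Lemma cvg_snd_entry (z : pts R S) i j :
  (fun y : pts R S => y.2 i j) @ z --> z.2 i j.
Proof. by apply: (@cvg_entry _ _ _ _ snd); exact: cvg_snd. Qed.

Lemma cvg_fst_comp (T : topologicalType) (f : 'rV[R]_S -> T) (z : pts R S) :
  f @ z.1 --> f z.1 -> (fun y : pts R S => f y.1) @ z --> f z.1.
Proof. by move=> h; apply: (@cvg_comp _ _ _ fst f _ _ _ _ h); exact: cvg_fst. Qed.

(** The rows of [z.2] span its plane, so tangency becomes a matrix equation, which is stable under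
    limits. *)
Lemma GmN_tangentP Qt (z : pts R S) : Q_ext Nbar N Qt -> N z.1 ->
  grass m z.2 ->
  (forall v, v *m z.2 = v -> tangent Nbar z.1 v) <-> z.2 *m Qt z.1 = z.2.
Proof.
move=> Qe Nz [Pt [PP _]]; have [_ _ tanE] := Q_ext_proj Qt z.1 Qe Nz; split.
  move=> h; apply/row_matrixP => i; rewrite row_mul; apply/tanE/h.
  by rewrite -row_mul PP.
by move=> PQ v vP; apply/tanE; rewrite -{1}vP -mulmxA PQ vP.
Qed.

Lemma GmN_closed Qt : Q_ext Nbar N Qt -> closed G.
Proof.
move=> Qe z clz.
have Nz : N z.1.
  have clN : closed N by apply: compact_closed => //; exact: norm_hausdorff.
  apply: clN => B Bz.
  have [y [[Ny _ _] By]] : (G `&` (fst @^-1` B)) !=set0.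
    by apply: clz; exact: (@cvg_fst _ _ (nbhs z.1) (nbhs z.2)).
  by exists y.1.
have Qc : Qt @ z.1 --> Qt z.1.
  by apply: differentiable_continuous; exact: Q_ext_differentiable.
have gP : grass m z.2.
  have Pt : z.2^T = z.2.
    apply/matrixP => i j; apply/eqP; rewrite -subr_eq0 mxE; apply/eqP.
    apply: (eq0_on_closure _ _ (fun y : pts R S => y.2 j i - y.2 i j) _ clz).
      by apply: cvgB; exact: cvg_snd_entry.
    by move=> y [_ [yt _] _]; rewrite -{1}yt mxE subrr.
  have PP : z.2 *m z.2 = z.2.
    apply/matrixP => i j; apply/eqP; rewrite -subr_eq0 mxE; apply/eqP.
    apply: (eq0_on_closure _ _
      (fun y : pts R S => \sum_k y.2 i k * y.2 k j - y.2 i j) _ clz).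
      apply: cvgB; last exact: cvg_snd_entry.
      by apply: cvg_fsum => k; apply: cvgM; exact: cvg_snd_entry.
    by move=> y [_ [_ [yy _]] _]; rewrite -{3}yy mxE subrr.
  split=> //; split=> //.
  have : \tr z.2 - m%:R = 0.
    apply: (eq0_on_closure _ _ (fun y : pts R S => \tr y.2 - m%:R) _ clz).
      apply: cvgB; last exact: cvg_cst.
      by apply: cvg_fsum => k; exact: cvg_snd_entry.
    by move=> y [_ [_ [yy <-]] _]; rewrite mxtrace_idempotent// subrr.
  by rewrite mxtrace_idempotent// => /eqP; rewrite subr_eq0 eqr_nat => /eqP.
split=> //; apply/(GmN_tangentP Qt z Qe Nz gP).
apply/matrixP => i j; apply/eqP; rewrite -subr_eq0 mxE; apply/eqP.
apply: (eq0_on_closure _ _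
  (fun y : pts R S => \sum_k y.2 i k * Qt y.1 k j - y.2 i j) _ clz).
  apply: cvgB; last exact: cvg_snd_entry.
  apply: cvg_fsum => k; apply: cvgM; first exact: cvg_snd_entry.
  by apply: cvg_entry; exact: cvg_fst_comp.
move=> y [Ny gy /(GmN_tangentP Qt y Qe Ny gy) yQ].
by rewrite -{2}yQ mxE subrr.
Qed.

Lemma GmN_compact Qt : Q_ext Nbar N Qt -> compact G.
Proof.
move=> Qe; apply: (subclosed_compact (GmN_closed Qt Qe)
  (compact_setX cptN (@compact_matrix_box R S S 1))).
move=> z [Nz [Pt [PP _]] _]; split => //= i j.
exact: symmetric_idempotent_entry.
Qed.

(** The sum over [k] is the derivative along row [j] of the projection, a tangent vector. Along a
    curve in [Nbar] with that velocity both extensions equal the projection onto the tangent space.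
    Thus one fixed [Qt] serves all varifolds, each of which comes with its own extension. *)
Lemma Qcorr_tangential Q1 Q2 z : Q_ext Nbar N Q1 -> Q_ext Nbar N Q2 -> G z ->
  Qcorr Q1 z = Qcorr Q2 z.
Proof.
move=> Q1e Q2e [Nz [_ [PP _]] tan].
have dirE Q i j : Q_ext Nbar N Q ->
    \sum_(k < S) z.2 j k * 'D_(ebasis R k) (fun y => Q y i j) z.1 =
    'D_(row j z.2) (fun y => Q y i j) z.1.
  move=> Qe; have dq : differentiable (fun y => Q y i j) z.1.
    by apply: differentiable_entry; exact: Q_ext_differentiable.
  rewrite deriveE// {1}(row_sum_delta (row j z.2)) linear_sum.
  by apply: eq_bigr => k _; rewrite deriveE// linearZ/= mxE.
apply/rowP => i; rewrite !mxE; apply: eq_bigr => j _; rewrite !dirE//.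
have [|c [c0 cN cv]] := tan (row j z.2); first by rewrite -row_mul PP.
have dc : differentiable c (0 : R) by apply/derivable1_diffP; case: cv.
have dE Q : Q_ext Nbar N Q ->
    'D_(row j z.2) (fun y => Q y i j) z.1 = 'D_1 (fun t => Q (c t) i j) (0 : R).
  move=> Qe; have dq : differentiable (fun y => Q y i j) (c 0).
    by rewrite c0; apply: differentiable_entry; exact: Q_ext_differentiable.
  rewrite (deriveE (f := (fun y => Q y i j) \o c)); last exact: differentiable_comp.
  rewrite diff_comp//= -(deriveE (f := c))// -c0 -deriveE//.
  by case: cv => _ ->.
rewrite !dE//; apply: near_eq_derive.
have [W1 [oW1 NW1 p1 _ _]] := Q1e; have [W2 [oW2 NW2 p2 _ _]] := Q2e.
have cc : c @ (0 : R) --> z.1 by rewrite -c0; exact: differentiable_continuous.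
have n1 : \forall t \near (0 : R), W1 (c t).
  by apply: cc; apply: open_nbhs_nbhs; split => //; exact: NW1.
have n2 : \forall t \near (0 : R), W2 (c t).
  by apply: cc; apply: open_nbhs_nbhs; split => //; exact: NW2.
near=> t.
have Nct : Nbar (c t) by near: t.
rewrite (orth_proj_unique (Q1 (c t)) (Q2 (c t)) (tangent Nbar (c t)))//.
  by apply: p1 => //; near: t.
by apply: p2 => //; near: t.
Unshelve. all: by end_near. Qed.

Lemma Qcorr_continuous Qt z i : Q_ext Nbar N Qt -> G z ->
  (fun y => Qcorr Qt y 0 i) @ z --> Qcorr Qt z 0 i.
Proof.
move=> Qe [Nz _ _]; have [W [oW NW _ dW cW]] := Qe.
have WE k : (fun y => 'D_(ebasis R k) Qt y) @ z.1 --> 'D_(ebasis R k) Qt z.1.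
  by apply: cW; rewrite inE; exact: NW.
rewrite mxE (_ : (fun y => Qcorr Qt y 0 i) = fun y : pts R S => \sum_(j < S) \sum_(k < S)
    y.2 j k * 'D_(ebasis R k) (fun x => Qt x i j) y.1); last first.
  by apply/funext => y; rewrite mxE.
apply: cvg_fsum => j; apply: cvg_fsum => k.
apply: cvgM; first exact: cvg_snd_entry.
apply: (@cvg_fst_comp _ (fun x => 'D_(ebasis R k) (fun y => Qt y i j) x)).
rewrite derive_entry; last exact: Q_ext_differentiable.
have cD : (fun x => ('D_(ebasis R k) Qt x) i j) @ z.1 --> ('D_(ebasis R k) Qt z.1) i j.
  exact: cvg_entry.
have nW : nbhs z.1 W by apply: open_nbhs_nbhs; split => //; exact: NW.
have eqD : \forall x \near z.1, ('D_(ebasis R k) Qt x) i j =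
    'D_(ebasis R k) (fun y => Qt y i j) x.
  by near=> x; rewrite derive_entry//; apply: dW; near: x.
exact: cvg_trans (near_eq_cvg eqD) cD.
Unshelve. all: by end_near. Qed.

End grassmann_bundle.

(** * Integral inequalities *)

(** The integral of a nonnegative function is a supremum over simple minorants, so it is monotone as
    it stands. Measurability of z |-> F z (HN z) then never has to be proved. *)
Lemma ge0_le_integral_nonmeasurable (d : measure_display) (X : measurableType d)
    (R : realType) (V : {measure set X -> \bar R}) (D : set X) (f g : X -> \bar R) :
  (forall x, D x -> (0 <= f x)%E) -> (forall x, D x -> (f x <= g x)%E) ->
  (\int[V]_(x in D) f x <= \int[V]_(x in D) g x)%E.
Proof.
move=> f0 fg.
have g0 x : D x -> (0 <= g x)%E by move=> Dx; exact: le_trans (f0 x Dx) (fg x Dx).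
rewrite !ge0_integralE//; apply: le_ereal_sup => _ /= [h hf <-].
by exists h => // x; apply: le_trans (hf x) _; exact: lee_restrict.
Qed.

Lemma integral_concentrated (d : measure_display) (X : measurableType d)
    (R : realType) (V : {measure set X -> \bar R}) (K : set X) (f : X -> \bar R) :
  measurable K -> V (~` K) = 0%E -> measurable_fun setT f ->
  (\int[V]_x f x = \int[V]_(x in K) f x)%E.
Proof.
move=> mK VK mf; rewrite [RHS]integral_mkcond; apply: ae_eq_integral => //.
  by apply/(measurable_restrictT _ _).1 => //; exact: measurable_funS mf.
exists (~` K); split => //; first exact: measurableC.
by move=> x /= h Kx; apply: h => _; rewrite patchE mem_set.
Qed.

Lemma Rintegral_affine_bound (d : measure_display) (X : measurableType d)
    (R : realType) (V : {measure set X -> \bar R}) (D : set X) (h g : X -> R)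
    (a b : R) :
  measurable D -> V.-integrable D (EFin \o h) ->
  (forall x, D x -> 0 <= g x) -> 0 <= a -> 0 < b ->
  (forall x, D x -> `|h x| <= a + b * g x) ->
  (`|\int[V]_(x in D) h x|%:E <= a%:E * V D + b%:E * \int[V]_(x in D) (g x)%:E)%E.
Proof.
move=> mD ih g0 a0 b0 hg.
have mh : measurable_fun D h by apply/measurable_EFinP; exact: (measurable_int V).
(* [k] is a measurable minorant of the possibly non-measurable [g] *)
pose k x := Num.max 0 ((`|h x| - a) / b).
have mk : measurable_fun D k.
  apply: measurable_maxr; first exact: measurable_cst.
  apply: measurable_funM; last exact: measurable_cst.
  apply: measurable_funB; last exact: measurable_cst.
  exact: measurableT_comp.
have k0 x : 0 <= k x by rewrite /k le_max lexx.
have kg x : D x -> k x <= g x.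
  move=> Dx; rewrite /k ge_max g0// ler_pdivrMr// lerBlDl mulrC; exact: hg.
have hk x : `|h x| <= a + b * k x.
  by rewrite -lerBlDl mulrC -ler_pdivrMr// /k le_max lexx orbT.
rewrite EFin_normr_Rintegral//.
apply: le_trans (le_abse_integral _ mD _) _; first exact: (measurable_int V).
apply: (@le_trans _ _ (\int[V]_(x in D) (a%:E + b%:E * (k x)%:E))%E).
  by apply: ge0_le_integral_nonmeasurable => x Dx //=; rewrite -EFinM -EFinD lee_fin.
have mkE : measurable_fun D (EFin \o k) by exact/measurable_EFinP.
rewrite ge0_integralD//=; last 2 first.
- by move=> x _; rewrite -EFinM lee_fin mulr_ge0// ltW.
- by apply: measurable_funeM.
rewrite integral_cst// ge0_integralZl_EFin//; last 2 first.
- by move=> x _; rewrite lee_fin.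
- exact: ltW.
rewrite leeD2l// lee_pmul2l//.
by apply: ge0_le_integral_nonmeasurable => x Dx /=; rewrite lee_fin; [exact: k0|exact: kg].
Qed.

(** * Consequences of condition (F) *)

Section integrands.
Context {R : realType} {S : nat}.
Variables (m : nat) (Nbar N : set 'rV[R]_S).
Local Notation G := (GmN m Nbar N).

Lemma entry_le_norm (p q : nat) (M : 'M[R]_(p, q)) i j : `|M i j| <= `|M|.
Proof.
rewrite [leRHS]/Num.Def.normr/= mx_normrE.
exact: (le_bigmax _ (fun ij => `|M ij.1 ij.2|) (i, j)).
Qed.

(** On the compact product of [G] with the sphere |q| = e, [F] has a positive minimum [dl].
    Convexity and F z 0 = 0 then give F z q >= dl * |q| / e outside the ball, whence C = e / dl. *)
Lemma condF_coercive F (e : R) : condF m Nbar N F -> compact G -> 0 < e ->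
  exists2 C : R, 0 < C & forall z q, G z -> `|q| <= e + C * F z q.
Proof.
move=> [cF F0 Fz Fcvx _] cG e0.
have [dl dl0 hdl] : exists2 dl : R, 0 < dl &
    forall z q, G z -> `|q| = e -> dl <= F z q.
  pose sph : set 'rV[R]_S := [set q | `|q| = e].
  have csph : compact sph.
    apply: bounded_closed_compact.
      exists e; split; first by rewrite num_real.
      by move=> M eM q /= ->; exact: ltW.
    have -> : sph = (fun q : 'rV[R]_S => `|q|) @^-1` [set e] by [].
    apply: closed_comp => [q _|]; last exact: closed_eq.
    exact: norm_continuous.
  have [D0|D0] := eqVneq (G `*` sph) set0.
    by exists 1 => // z q Gz qe; have : (G `*` sph) (z, q) by []; rewrite D0.
  have cD := compact_setX cG csph.
  have cFD : {within G `*` sph, continuous (fun p => F p.1 p.2)}.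
    by apply: continuous_subspaceW cF => p [].
  have [[z0 q0] + hmin] := compact_EVT_min ((set0P _).1 D0) cD cFD.
  rewrite inE => -[/= Gz0 sq0].
  exists (F z0 q0); last by move=> z q Gz qe; apply: (hmin (z, q)); rewrite inE.
  rewrite lt0r F0// andbT; apply/eqP => /(Fz _ _ Gz0) q00.
  by move: sq0; rewrite /sph /= q00 normr0 => e00; rewrite -e00 ltxx in e0.
exists (e / dl); first by rewrite divr_gt0.
move=> z q Gz; have [qe|qe] := leP `|q| e.
  by rewrite (le_trans qe)// lerDl mulr_ge0 ?F0// ltW// divr_gt0.
have q0 : 0 < `|q| by exact: lt_trans qe.
(* This factor brings [q] back to the sphere, on the segment from 0 to [q]. *)
pose t := e / `|q|.
have t01 : 0 <= t <= 1 by rewrite divr_ge0 ?(ltW e0)//= ler_pdivrMr// mul1r ltW.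
have tq : `|t *: q| = e.
  by rewrite normrZ ger0_norm ?divfK ?gt_eqF//; case/andP: t01.
have := Fcvx z q 0 t Gz t01; rewrite scaler0 addr0 (Fz z 0 Gz).2// mulr0 addr0.
move=> /(le_trans (hdl z _ Gz tq)); rewrite /t mulrAC ler_pdivlMr// => h.
rewrite -mulrA [_^-1 * _]mulrC mulrA -{1}[`|q|]add0r lerD ?(ltW e0)//.
by rewrite ler_pdivlMr// mulrC.
Qed.

Lemma condF_dotp : condF m Nbar N (fun _ q => dotp q q).
Proof.
have dge0 (q : 'rV[R]_S) : 0 <= dotp q q.
  by apply: sumr_ge0 => i _; rewrite -expr2 sqr_ge0.
split.
- apply: continuous_subspaceT => p; apply: cvg_fsum => i.
  have ci : (fun x : pts R S * 'rV[R]_S => x.2 0 i) @ p --> p.2 0 i.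
    by apply: (@cvg_entry _ _ _ _ snd); exact: cvg_snd.
  exact: cvgM.
- by move=> z q _; exact: dge0.
- move=> z q _; split=> [/eqP|->]; last first.
    by rewrite /dotp big1// => i _; rewrite mxE mulr0.
  rewrite psumr_eq0 => [/allP h|i _]; last by rewrite -expr2 sqr_ge0.
  apply/rowP => i; rewrite mxE; apply/eqP.
  by have := h i (mem_index_enum _); rewrite /= mulf_eq0 orbb.
- move=> z q1 q2 t _ /andP[t0 t1]; rewrite /dotp !mulr_sumr -big_split/=.
  apply: ler_sum => i _; rewrite !mxE -subr_ge0.
  set a := q1 0 i; set b := q2 0 i.
  (* The convexity defect of the square function. *)
  rewrite (_ : _ - _ = t * (1 - t) * (a - b) ^+ 2); last by ring.
  by rewrite mulr_ge0 ?sqr_ge0// mulr_ge0// subr_ge0.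
- exists (fun _ t => t); split=> //.
  + by apply: continuous_subspaceT => p; exact: cvg_snd.
  + by move=> z0 _ M; exists setT; [exact: filterT|exists M].
  + by move=> z q _; rewrite /enorm -expr2 sqr_sqrtr.
Qed.

Lemma dotp_bound (u v : 'rV[R]_S) (M : R) :
  `|v| <= M -> `|dotp u v| <= S%:R * M * `|u|.
Proof.
move=> vM; apply: le_trans (ler_norm_sum _ _ _) _.
rewrite -[S in S%:R]card_ord -mulrA mulr_natl -sumr_const.
apply: ler_sum => i _; rewrite normrM mulrC ler_pM// ?entry_le_norm//.
exact: le_trans (entry_le_norm _ _ _ _ _) vM.
Qed.

End integrands.

(** * First variation relative to the ambient manifold *)

Section first_variation.
Context {R : realType} {S : nat}.
Variables (m : nat) (Nbar N : set 'rV[R]_S).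
Hypotheses (NNbar : N `<=` Nbar) (cptN : compact N).
Local Notation G := (GmN m Nbar N).
Variable Qt : 'rV[R]_S -> 'M[R]_S.
Hypothesis Qe : Q_ext Nbar N Qt.
Variable X : 'rV[R]_S -> 'rV[R]_S.
Hypothesis CX : C1c X.

Let cptG : compact G. Proof. exact: GmN_compact NNbar cptN Qt Qe. Qed.
Let closedG : closed G. Proof. exact: GmN_closed NNbar cptN Qt Qe. Qed.
Let mG : measurable (G : set (borel_pts R S)). Proof. exact: closed_borel. Qed.

Lemma cvg_field (z : pts R S) i :
  (fun y : pts R S => X y.1 0 i) @ z --> X z.1 0 i.
Proof.
have [dX _ _] := CX.
apply: (@cvg_entry _ _ _ _ (fun y : pts R S => X y.1)); apply: cvg_fst_comp.
exact: differentiable_continuous.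
Qed.

Lemma cvg_divP (z : pts R S) :
  (fun y : pts R S => divP y.2 X y.1) @ z --> divP z.2 X z.1.
Proof.
have [dX cX _] := CX; apply: cvg_fsum => i; apply: cvg_fsum => j.
apply: cvgM; first exact: cvg_snd_entry.
rewrite (_ : (fun y : pts R S => _) =
    fun y : pts R S => ('D_(ebasis R j) X y.1) 0 i); last first.
  by apply/funext => y; rewrite derive_entry.
rewrite derive_entry//.
apply: (@cvg_entry _ _ _ _ (fun y : pts R S => 'D_(ebasis R j) X y.1)).
by apply: (cvg_fst_comp _ (fun x => 'D_(ebasis R j) X x)); exact: cX.
Qed.

Lemma cvg_dotp_Qcorr z : G z ->
  (fun y => dotp (Qcorr Qt y) (X y.1)) @ z --> dotp (Qcorr Qt z) (X z.1).
Proof.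
move=> Gz; apply: cvg_fsum => i; apply: cvgM; last exact: cvg_field.
exact: (Qcorr_continuous m Nbar N).
Qed.

Lemma within_divP : {within G, continuous (fun z : pts R S => divP z.2 X z.1)}.
Proof. by apply: continuous_subspaceT => z; exact: cvg_divP. Qed.

Lemma within_dotp_Qcorr :
  {within G, continuous (fun z => dotp (Qcorr Qt z) (X z.1))}.
Proof.
by apply: continuous_in_subspaceT => z; rewrite inE; exact: cvg_dotp_Qcorr.
Qed.

(** Integrand of the first variation relative to [Nbar]. It is continuous on [G] and does not
    involve the curvature, so its integral passes to weak limits. *)
Definition rel_div (z : pts R S) : R := divP z.2 X z.1 + dotp (Qcorr Qt z) (X z.1).

Lemma within_rel_div : {within G, continuous rel_div}.
Proof.
apply: continuous_in_subspaceT => z; rewrite inE => Gz.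
by apply: cvgD; [exact: cvg_divP|exact: cvg_dotp_Qcorr].
Qed.

Lemma measurable_divP :
  measurable_fun setT (fun z : borel_pts R S => divP z.2 X z.1).
Proof.
apply: within_continuous_borel; first exact: closedT.
by apply: continuous_subspaceT => z; exact: cvg_divP.
Qed.

Lemma measurable_field i :
  measurable_fun setT (fun z : borel_pts R S => X z.1 0 i).
Proof.
apply: within_continuous_borel; first exact: closedT.
by apply: continuous_subspaceT => z; exact: cvg_field.
Qed.

Lemma field_bound : exists2 M : R, 0 < M & forall z, G z -> `|X z.1| <= M.
Proof.
have cc : {within G, continuous (fun z : pts R S => X z.1)}.
  apply: continuous_subspaceT => z; apply: cvg_fst_comp.
  by have [dX _ _] := CX; exact: differentiable_continuous.
have /compact_bounded/ex_strict_bound_gt0[M M0 /= hM] :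
  compact ((fun z : pts R S => X z.1) @` G) by exact: continuous_compact.
by exists M => // z Gz; apply: ltW; apply: hM; exists z.
Qed.

Variable V : {measure set (borel_pts R S) -> \bar R}.
Hypothesis varV : varifold_on m Nbar N V.

Let VG : (V G < +oo)%E.
Proof.
by case: varV => h _; apply: le_lt_trans h; apply: le_measure; rewrite ?inE.
Qed.

Lemma within_continuous_integrable (f : pts R S -> R) :
  {within G, continuous f} -> V.-integrable (G : set (borel_pts R S)) (EFin \o f).
Proof.
move=> cf; have [mf [M hM]] := continuous_bounded_borel G cptG f cf.
by apply: (@bounded_osc_integrable _ _ _ _ _ _ 0 M) => // z Gz; rewrite subr0 hM.
Qed.

Lemma measurable_dotp_field (H : borel_pts R S -> 'rV[R]_S) :
  (forall i, V.-integrable setT (fun z => (H z 0 i)%:E)) ->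
  measurable_fun setT (fun z : borel_pts R S => dotp (H z) (X z.1)).
Proof.
move=> iH; apply: measurable_sum => i; apply: measurable_funM.
  by apply/measurable_EFinP; exact: (measurable_int V (iH i)).
exact: measurable_field.
Qed.

Lemma integrable_dotp_field (H : borel_pts R S -> 'rV[R]_S) :
  (forall i, V.-integrable setT (fun z => (H z 0 i)%:E)) ->
  V.-integrable (G : set (borel_pts R S)) (EFin \o (fun z => dotp (H z) (X z.1))).
Proof.
move=> iH; have [M M0 hM] := field_bound.
pose g (z : borel_pts R S) : \bar R := (\sum_(i < S) `|(M%:E * (H z 0 i)%:E)|)%E.
apply: (@le_integrable _ _ _ V G mG _ g).
- by apply/measurable_EFinP; apply: measurable_funS (measurable_dotp_field H iH).
- move=> z Gz; have -> : g z = (\sum_(i < S) `|M * H z 0 i|)%:E.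
    by rewrite -sumEFin.
  rewrite /= lee_fin [leRHS]ger0_norm ?sumr_ge0//.
  apply: le_trans (ler_norm_sum _ _ _) _; apply: ler_sum => i _.
  rewrite !normrM mulrC ler_wpM2r// (gtr0_norm M0).
  exact: le_trans (entry_le_norm _ _ _ _ _) (hM z Gz).
- apply: integrable_sum => // i _; apply: integrable_abse; apply: integrableZl => //.
  exact: integrableS (iH i).
Qed.

(** Restrict the Euclidean identity to [G], where [V] is concentrated, and add the integral of Qcorr
    . X to both sides; [Qcorr_tangential] replaces the extension supplied with [HN] by [Qt]. *)
Lemma first_variation_identity (HN : borel_pts R S -> 'rV[R]_S) :
  has_wmc_rel m Nbar N V HN ->
  V.-integrable (G : set (borel_pts R S)) (EFin \o (fun z => dotp (HN z) (X z.1))) /\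
  \int[V]_(z in (G : set (borel_pts R S))) rel_div z =
    - \int[V]_(z in (G : set (borel_pts R S))) dotp (HN z) (X z.1).
Proof.
move=> [Q' [HR [Q'e [iHR wmc] HNE]]].
have [_ VCG] := varV.
have iR := integrable_dotp_field HR iHR.
have iQ := within_continuous_integrable _ within_dotp_Qcorr.
have iD := within_continuous_integrable _ within_divP.
have NE z : z \in (G : set (borel_pts R S)) ->
    dotp (HR z) (X z.1) - dotp (Qcorr Qt z) (X z.1) = dotp (HN z) (X z.1).
  rewrite inE => Gz; rewrite HNE// (Qcorr_tangential m Nbar N Q' Qt z)//.
  by rewrite /dotp -sumrB; apply: eq_bigr => i _; rewrite !mxE mulrBl.
have := wmc X CX.
rewrite (@integral_concentrated _ _ _ V G (fun z => (divP z.2 X z.1)%:E) mG VCG); last first.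
  by apply/measurable_EFinP; exact: measurable_divP.
rewrite (@integral_concentrated _ _ _ V G (fun z => (dotp (HR z) (X z.1))%:E) mG VCG); last first.
  by apply/measurable_EFinP; exact: measurable_dotp_field.
move=> /(congr1 fine); rewrite fineN => DE.
split.
  apply: (@eq_integrable _ _ _ V G mG ((EFin \o (fun z => dotp (HR z) (X z.1))) \-
    (EFin \o (fun z => dotp (Qcorr Qt z) (X z.1))))%E).
    by move=> z Gz /=; rewrite -EFinB NE.
  exact: integrableB.
rewrite [in RHS](@eq_Rintegral _ _ _ V G (fun z =>
  dotp (HR z) (X z.1) - dotp (Qcorr Qt z) (X z.1))); last first.
  by move=> z Gz /=; rewrite NE.
rewrite RintegralB// RintegralD// opprB addrC; congr (_ + _); exact: DE.
Qed.

End first_variation.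

(** * The compactness argument *)

Section compactness_argument.
Context {R : realType} {S : nat}.
Variables (m : nat) (Nbar N : set 'rV[R]_S).
Hypotheses (NNbar : N `<=` Nbar) (cptN : compact N).
Local Notation G := (GmN m Nbar N).
Local Notation B := (borel_pts R S).

Lemma null_first_variation Qt (V : {measure set B -> \bar R}) :
  Q_ext Nbar N Qt -> varifold_on m Nbar N V ->
  (forall X, C1c X -> \int[V]_(z in (G : set B)) rel_div Qt X z = 0) ->
  has_wmc_rel m Nbar N V (fun=> 0).
Proof.
move=> Qe varV rel_div0; have [VT VCG] := varV.
have cptG : compact G by exact: GmN_compact NNbar cptN Qt Qe.
have mG : measurable (G : set B).
  by apply: closed_borel; exact: GmN_closed NNbar cptN Qt Qe.
(* A null relative curvature forces the Euclidean curvature to equal [Qcorr] on [G]. The value zero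
   off [G] makes it integrable on the whole space. *)
pose HR (z : B) : 'rV[R]_S := if z \in G then Qcorr Qt z else 0.
have HRE z : G z -> HR z = Qcorr Qt z by move=> Gz; rewrite /HR mem_set.
have iHR i : V.-integrable setT (fun z => (HR z 0 i)%:E).
  have cQ : {within G, continuous (fun z => Qcorr Qt z 0 i)}.
    apply: continuous_in_subspaceT => z; rewrite inE => Gz.
    exact: (Qcorr_continuous m Nbar N).
  have iQ := within_continuous_integrable m Nbar N NNbar cptN Qt Qe V varV _ cQ.
  have := (integrable_mkcond _ mG).1 iQ.
  apply: eq_integrable => // z _; rewrite patchE /HR.
  by case: ifP => _ //=; rewrite mxE.
exists Qt, HR; split=> //; last by move=> z Gz; rewrite HRE// subrr.
split=> // X CX.
rewrite (@integral_concentrated _ _ _ V G (fun z => (divP z.2 X z.1)%:E) mG VCG); last first.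
  by apply/measurable_EFinP; exact: measurable_divP.
rewrite (@integral_concentrated _ _ _ V G (fun z => (dotp (HR z) (X z.1))%:E) mG VCG); last first.
  by apply/measurable_EFinP; exact: (measurable_dotp_field _ CX V).
have iD := within_continuous_integrable m Nbar N NNbar cptN Qt Qe V varV _
  (within_divP m Nbar N X CX).
have iR := integrable_dotp_field m Nbar N NNbar cptN Qt Qe X CX V HR iHR.
have : \int[V]_(z in (G : set B)) divP z.2 X z.1 = - \int[V]_(z in (G : set B)) dotp (HR z) (X z.1).
  apply/eqP; rewrite -subr_eq0 opprK -RintegralD//; apply/eqP.
  rewrite -[RHS](rel_div0 X CX); apply: eq_Rintegral => z; rewrite inE => Gz.
  by rewrite HRE.
rewrite /Rintegral => DE.
by rewrite -[LHS]fineK ?DE ?EFinN ?fineK//; apply: integrable_fin_num.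
Qed.

Lemma linear_estimate (F : pts R S -> 'rV[R]_S -> R) :
  (forall V : {measure set B -> \bar R}, varifold_on m Nbar N V ->
     has_wmc_rel m Nbar N V (fun=> 0) -> V setT = 0%E) ->
  condF m Nbar N F ->
  exists C : R, 0 < C /\ forall (V : {measure set B -> \bar R}) HN,
    varifold_on m Nbar N V -> has_wmc_rel m Nbar N V HN ->
    (V setT <= C%:E * \int[V]_(z in (G : set B)) (F z (HN z))%:E)%E.
Proof.
move=> no_null cF; apply: contrapT => noC.
have /choice[VH hVH] (k : nat) : exists VH : {measure set B -> \bar R} * (B -> 'rV[R]_S),
    [/\ varifold_on m Nbar N VH.1, has_wmc_rel m Nbar N VH.1 VH.2 &
        (k.+1%:R%:E * \int[VH.1]_(z in (G : set B)) (F z (VH.2 z))%:E < VH.1 setT)%E].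
  apply: contrapT => noVH; apply: noC; exists k.+1%:R; split => // V HN vV wV.
  by rewrite leNgt; apply/negP => lt; apply: noVH; exists (V, HN).
pose V k := (VH k).1; pose HN k := (VH k).2.
have vV k : varifold_on m Nbar N (V k) by case: (hVH k).
have wV k : has_wmc_rel m Nbar N (V k) (HN k) by case: (hVH k).
pose I k := (\int[V k]_(z in (G : set B)) (F z (HN k z))%:E)%E.
have ltV k : (k.+1%:R%:E * I k < V k setT)%E by case: (hVH k).
(* An extension of the projection field is supplied by the first of the counterexamples. *)
have [Qt Qe] : exists Qt, Q_ext Nbar N Qt by case: (wV 0%N) => Qt [? []]; exists Qt.
have cptG : compact G by exact: GmN_compact NNbar cptN Qt Qe.
have mG : measurable (G : set B).
  by apply: closed_borel; exact: GmN_closed NNbar cptN Qt Qe.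
have [_ F0 _ _ _] := cF.
have I0 k : (0 <= I k)%E by apply: integral_ge0 => z Gz; rewrite lee_fin F0.
have Vfin k : (V k setT < +oo)%E by case: (vV k).
have Vgt k : (0 < V k setT)%E by apply: le_lt_trans (ltV k); rewrite mule_ge0.
have Vout k : V k (~` G) = 0%E by case: (vV k).
have [Vl [Vl1 VlG Vlim]] := weak_limit_point _ _ G V cptG Vfin Vgt Vout.
have varVl : varifold_on m Nbar N Vl by split; rewrite ?Vl1 ?ltry.
suff /(no_null Vl varVl) : has_wmc_rel m Nbar N Vl (fun=> 0).
  by rewrite Vl1 => /eqP; rewrite onee_eq0.
apply: (null_first_variation Qt) => // X CX.
apply: Vlim; first exact: within_rel_div.
have [M M0 hM] := field_bound m Nbar N NNbar cptN Qt Qe X CX.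
have ft := fun k => first_variation_identity m Nbar N NNbar cptN Qt Qe X CX
  (V k) (vV k) (HN k) (wV k).
(* A Lipschitz constant for q |-> q . X on [G]; adding 1 ensures positivity even if S = 0. *)
pose A := S%:R * M + 1.
have A0 : 0 < A by rewrite ltr_wpDl// mulr_ge0// ltW.
have v0 k : 0 < fine (V k setT) by rewrite fine_gt0// Vgt Vfin.
apply/cvgrPdist_le => e e0.
(* Coercivity is applied at level e / 2 / A, so that multiplying by [A] leaves the error e / 2. The
   remaining term is A * C times the normalised energy, which is at most 1/(k+1). *)
have e2A : 0 < e / 2 / A by rewrite !divr_gt0.
have [C C0 hC] := condF_coercive m Nbar N F (e / 2 / A) cF cptG e2A.
have key k : `|(\int[V k]_(z in (G : set B)) rel_div Qt X z) / fine (V k setT)| <=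
    e / 2 + A * C / k.+1%:R.
  have [ih ->] := ft k.
  rewrite normrM normrN normfV [X in _ / X]gtr0_norm// ler_pdivrMr//.
  have e20 : 0 <= e / 2 by rewrite ltW// divr_gt0.
  have hF z : G z -> `|dotp (HN k z) (X z.1)| <= e / 2 + A * C * F z (HN k z).
    move=> Gz; apply: le_trans (dotp_bound _ _ _ (hM z Gz)) _.
    apply: (@le_trans _ _ (A * `|HN k z|)).
      by rewrite ler_wpM2r// lerDl.
    apply: le_trans (ler_wpM2l (ltW A0) (hC z (HN k z) Gz)) _.
    by rewrite mulrDr [A * (e / 2 / A)]mulrC divfK ?gt_eqF// mulrA.
  have h := @Rintegral_affine_bound _ _ _ (V k) G _ (fun z => F z (HN k z))
    (e / 2) (A * C) mG ih (fun z Gz => F0 _ _ Gz) e20 (mulr_gt0 A0 C0) hF.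
  have vE : V k setT = (fine (V k setT))%:E by rewrite fineK// ge0_fin_numE.
  have VG : (V k G <= (fine (V k setT))%:E)%E.
    by rewrite -vE; apply: le_measure; rewrite ?inE.
  have Ile : (I k <= (k.+1%:R^-1)%:E * (fine (V k setT))%:E)%E.
    by rewrite lee_pdivlMl// -vE ltW.
  rewrite -lee_fin; apply: le_trans h _.
  set v := fine (V k setT) in VG Ile *.
  rewrite (_ : (_ * v)%:E = (e / 2)%:E * v%:E + (A * C)%:E * (k.+1%:R^-1 * v)%:E)%E; last first.
    by rewrite -!EFinM -EFinD; congr EFin; ring.
  apply: leeD; first by apply: lee_wpmul2l; rewrite ?lee_fin.
  apply: lee_wpmul2l; last by rewrite EFinM.
  by rewrite lee_fin mulr_ge0// ltW.
near=> k; rewrite sub0r normrN (le_trans (key k))// [leRHS]splitr lerD2l.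
have AC0 : 0 < A * C by rewrite mulr_gt0.
rewrite -ler_pdivlMl// mulrC ltW//; near: k.
have d0 : 0 < e / 2 / (A * C) by rewrite !divr_gt0 ?mulr_gt0.
exact: (near_infty_natSinv_lt (PosNum d0)).
Unshelve. all: by end_near. Qed.

End compactness_argument.

(** * Equivalence of the three conditions *)

Theorem theorem4p6 (R : realType) (S n m : nat) (Nbar N : set 'rV[R]_S) :
  submanifold n Nbar -> N `<=` Nbar -> compact N ->
  (1 <= m)%N -> (m <= n - 1)%N ->
  let G := GmN m Nbar N in
  let cond_i :=
    forall V : {measure set borel_pts R S -> \bar R},
      varifold_on m Nbar N V -> has_wmc_rel m Nbar N V (fun _ => 0) ->
      V setT = 0%E in
  let cond_ii :=
    exists (Phi : R -> R) (F : pts R S -> 'rV[R]_S -> R),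
      [/\ Phi 0 = 0,
          (forall t, 0 <= t -> 0 <= Phi t),
          (forall s t, 0 <= s -> s < t -> Phi s < Phi t),
          condF m Nbar N F &
          forall (V : {measure set borel_pts R S -> \bar R}) HN,
            varifold_on m Nbar N V -> has_wmc_rel m Nbar N V HN ->
            let I := (\int[V]_(z in G) (F z (HN z))%:E)%E in
            I = +oo%E \/ (V setT <= (Phi (fine I))%:E)%E] in
  let cond_iii :=
    forall F : pts R S -> 'rV[R]_S -> R, condF m Nbar N F ->
      exists C : R, 0 < C /\
        forall (V : {measure set borel_pts R S -> \bar R}) HN,
          varifold_on m Nbar N V -> has_wmc_rel m Nbar N V HN ->
          (V setT <= C%:E * \int[V]_(z in G) (F z (HN z))%:E)%E in
  (cond_i <-> cond_ii) /\ (cond_ii <-> cond_iii).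
Proof.
move=> _ NNbar cptN _ _ G cond_i cond_ii cond_iii.
have i_iii : cond_i -> cond_iii.
  by move=> hi F cF; exact: linear_estimate.
have iii_ii : cond_iii -> cond_ii.
  move=> hiii; have [C [C0 hC]] := hiii _ (condF_dotp m Nbar N).
  exists (fun t => C * t), (fun _ q => dotp q q); split.
  - by rewrite mulr0.
  - by move=> t t0; rewrite mulr_ge0// ltW.
  - by move=> s t _ st; rewrite ltr_pM2l.
  - exact: condF_dotp.
  (* The infinite case is separated because [fine] sends +oo to 0. *)
  - move=> V HN vV wV I; have [->|Ioo] := eqVneq I +oo%E; [by left|right].
    have I0 : (0 <= I)%E.
      apply: integral_ge0 => z _; rewrite lee_fin sumr_ge0// => i _.
      by rewrite -expr2 sqr_ge0.
    have Ifin : I \is a fin_num by rewrite ge0_fin_numE// ltey.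
    by rewrite EFinM fineK//; exact: hC.
have ii_i : cond_ii -> cond_i.
  move=> [Phi [F [Phi0 _ _ cF h]]] V vV wV.
  have I0 : (\int[V]_(z in G) (F z 0)%:E = 0)%E.
    apply: integral0_eq => z Gz.
    by have [_ _ F0 _ _] := cF; rewrite (F0 z 0 Gz).2.
  have [] := h V (fun=> 0) vV wV; rewrite I0 => //.
  by rewrite /= Phi0 => V0; apply/eqP; rewrite eq_le V0 measure_ge0.
by split; split; auto.
Qed.
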